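(* Let $w\in\mathbb C^n$, $y\in\mathbb C^m$, and let $R=(R_1,\dots,R_J)$ with $R_j\in\mathbb C\{w,y\}$. Suppose that $\hat g(w)=(\hat g_1(w),\dots,\hat g_m(w))\in\mathbb C[[w]]^m$ are formal power series without constant term solving $R(w,\hat g(w))\equiv 0$ in $\mathbb C[[w]]$. If $J\ge m$ and if there exist $1\le j_1<j_2<\cdots<j_m\le J$ such that $$\det\Big(\frac{\partial R_{j_k}}{\partial y_l}(w,\hat g(w))\Big)_{1\le k,l\le m}\not\equiv 0\quad\text{in }\mathbb C[[w]],$$ then $\hat g(w)$ is convergent, i.e. $\hat g(w)\in\mathbb C\{w\}^m$.
   Context: $\mathbb C[[w]]$ denotes the ring of formal power series and $\mathbb C\{w\}$, $\mathbb C\{w,y\}$ the rings of convergent power series. *)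

(* Defs.v *)
From HB Require Import structures.
From mathcomp Require Import all_boot all_order all_algebra.
From mathcomp Require Import boolp classical_sets reals ereal esum.
From mathcomp Require Import complex.
(* The grammar of mpoly clashes with that of the classical library, hence the
   import without its notations. *)
From mathcomp Require Import -(notations) ssrcomplements mpoly.

Set Implicit Arguments.
Unset Strict Implicit.
Unset Printing Implicit Defensive.

Import Order.TTheory GRing.Theory Num.Theory.

Local Open Scope ring_scope.

Record fps (K : Type) (n : nat) := Fps { fps_coef :> multinom n -> K }.

Lemma fpsP (K : Type) (n : nat) (f g : fps K n) :
  (forall m, f m = g m) -> f = g.
Proof. by case: f g => [f] [g] /= fg; congr Fps; apply/funext. Qed.

HB.instance Definition _ (K : Type) (n : nat) := gen_eqMixin (fps K n).
HB.instance Definition _ (K : Type) (n : nat) := gen_choiceMixin (fps K n).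

Section FpsRing.
Context (K : comNzRingType) (n : nat).
Implicit Types (f g h : fps K n) (m : multinom n).

Definition fps_zero : fps K n := Fps (fun=> 0).
Definition fps_opp f : fps K n := Fps (fun m => - f m).
Definition fps_add f g : fps K n := Fps (fun m => f m + g m).

Lemma fps_addA : associative fps_add.
Proof. by move=> f g h; apply: fpsP => m /=; rewrite addrA. Qed.
Lemma fps_addC : commutative fps_add.
Proof. by move=> f g; apply: fpsP => m /=; rewrite addrC. Qed.
Lemma fps_add0 : left_id fps_zero fps_add.
Proof. by move=> f; apply: fpsP => m /=; rewrite add0r. Qed.
Lemma fps_addN : left_inverse fps_zero fps_opp fps_add.
Proof. by move=> f; apply: fpsP => m /=; rewrite addNr. Qed.

HB.instance Definition _ := GRing.isZmodule.Build (fps K n)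
  fps_addA fps_addC fps_add0 fps_addN.

Definition fps_one : fps K n := Fps (fun m => (m == mnm0)%:R).

(* The Cauchy product: the multi-indices [k <= m] (componentwise) all have
   total degree at most that of [m]. *)
Definition fps_mul f g : fps K n := Fps (fun m =>
  \sum_(k : bmultinom n (mdeg m).+1 | lem k m) f k * g (mnm_sub m k)).

Definition fps_trunc d f : mpoly n K :=
  \sum_(k : bmultinom n d) f k *: mpolyX K k.

Lemma mcoeff_fps_trunc d f m :
  (mdeg m < d)%N -> mcoeff m (fps_trunc d f) = f m.
Proof. by move=> md; rewrite /fps_trunc mcoeff_mpoly. Qed.

Lemma mdeg_sub_lt d m k : (mdeg m < d)%N -> (mdeg (mnm_sub m k) < d)%N.
Proof.
move=> md; apply: leq_ltn_trans md; rewrite !mdegE leq_sum // => i _.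
by rewrite mnmBE leq_subr.
Qed.

Lemma mcoeffM_lin d (p q : mpoly n K) m : (mdeg m < d)%N ->
  mcoeff m (p * q) =
  \sum_(k : bmultinom n d | lem k m) mcoeff k p * mcoeff (mnm_sub m k) q.
Proof. exact: mcoeff_poly_mul_lin. Qed.

Lemma mcoeffM_eq d (p p' q q' : mpoly n K) m : (mdeg m < d)%N ->
  (forall k, (mdeg k < d)%N -> mcoeff k p = mcoeff k p') ->
  (forall k, (mdeg k < d)%N -> mcoeff k q = mcoeff k q') ->
  mcoeff m (p * q) = mcoeff m (p' * q').
Proof.
move=> md pp qq; rewrite !(mcoeffM_lin _ _ md); apply: eq_bigr => k _.
by rewrite pp ?bmdeg// qq// mdeg_sub_lt.
Qed.

Lemma fps_mul_trunc d f g m : (mdeg m < d)%N ->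
  fps_mul f g m = mcoeff m (fps_trunc d f * fps_trunc d g).
Proof.
move=> md.
rewrite (mcoeffM_eq (d := (mdeg m).+1) (p' := fps_trunc (mdeg m).+1 f)
  (q' := fps_trunc (mdeg m).+1 g) (ltnSn _)); last 2 first.
- by move=> k kd; rewrite !mcoeff_fps_trunc// (leq_ltn_trans _ md).
- by move=> k kd; rewrite !mcoeff_fps_trunc// (leq_ltn_trans _ md).
rewrite (mcoeffM_lin _ _ (ltnSn _)); apply: eq_bigr => k _.
by rewrite !mcoeff_fps_trunc ?bmdeg// mdeg_sub_lt.
Qed.

Lemma fps_mulC : commutative fps_mul.
Proof.
by move=> f g; apply: fpsP => m; rewrite !(fps_mul_trunc _ _ (ltnSn _)) mulrC.
Qed.

Lemma fps_mulA : associative fps_mul.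
Proof.
move=> f g h; apply: fpsP => m; pose d := (mdeg m).+1.
have md : (mdeg m < d)%N by exact: ltnSn.
rewrite !(fps_mul_trunc _ _ md).
transitivity (mcoeff m (fps_trunc d f * (fps_trunc d g * fps_trunc d h))).
  apply: (mcoeffM_eq md) => // k kd.
  by rewrite mcoeff_fps_trunc// (fps_mul_trunc _ _ kd).
rewrite mulrA; apply: (mcoeffM_eq md) => // k kd.
by rewrite mcoeff_fps_trunc// (fps_mul_trunc _ _ kd).
Qed.

Lemma fps_mul1 : left_id fps_one fps_mul.
Proof.
move=> f; apply: fpsP => m; pose d := (mdeg m).+1.
have md : (mdeg m < d)%N by exact: ltnSn.
rewrite (fps_mul_trunc _ _ md) -[RHS](mcoeff_fps_trunc f md).
rewrite -[fps_trunc d f in RHS]mul1r; apply: (mcoeffM_eq md) => // k kd.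
by rewrite mcoeff_fps_trunc//= mcoeff1.
Qed.

Lemma fps_mulDl : left_distributive fps_mul fps_add.
Proof.
move=> f g h; apply: fpsP => m /=; rewrite -big_split/=.
by apply: eq_bigr => k _; rewrite mulrDl.
Qed.

Lemma fps_one_neq0 : fps_one != 0.
Proof.
apply/eqP => /(congr1 (fun f : fps K n => f mnm0))/=.
by rewrite eqxx => /eqP; rewrite oner_eq0.
Qed.

HB.instance Definition _ := GRing.Zmodule_isComNzRing.Build (fps K n)
  fps_mulA fps_mulC fps_mul1 fps_mulDl fps_one_neq0.

Definition fps_X (i : 'I_n) : fps K n := Fps (fun m => (m == mnm1 i)%:R).

Definition fps_deriv (i : 'I_n) f : fps K n :=
  Fps (fun m => f (mnm_add m (mnm1 i)) *+ (m i).+1).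

End FpsRing.

(* [fps_subst f h] is $f(h_1,\dots,h_p)$; it is only meaningful when all the
   [h i] have zero constant term. The coefficient of index [m] in
   $h^k = \prod_i h_i^{k_i}$ then vanishes for [mdeg m < mdeg k], so the sum
   below is the whole sum $\sum_k f_k (h^k)_m$: see [fps_substE]. *)
Definition fps_subst (K : comNzRingType) (p n : nat)
    (f : fps K p) (h : 'I_p -> fps K n) : fps K n :=
  Fps (fun m => \sum_(k : bmultinom p (mdeg m).+1)
    f k * (\prod_(i < p) h i ^+ k i : fps K n) m).

(* $F(w, g(w))$: the variables of [F] are $(w_1,\dots,w_n,y_1,\dots,y_m)$. *)
Definition fps_subst_y (K : comNzRingType) (n m : nat)
    (F : fps K (n + m)) (g : 'I_m -> fps K n) : fps K n :=
  fps_subst F (fun k => match split k with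
                        | inl i => fps_X K i
                        | inr l => g l
                        end).

(* Absolute convergence on a polydisc centred at the origin. *)
Definition fps_convergent (R : realType) (n : nat) (f : fps R[i] n) : Prop :=
  exists2 r : R, 0 < r &
    forall z : 'I_n -> R[i], (forall i, Normc.normc (z i) < r) ->
      summable [set: multinom n]
        (fun a => (Normc.normc (f a * \prod_(i < n) z i ^+ a i))%:E).

Section FpsSubst.
Context (K : comNzRingType) (n : nat).
Implicit Types (f g : fps K n) (m : multinom n).

Lemma fps_mul_order d e f g :
  (forall m, (mdeg m < d)%N -> f m = 0) ->
  (forall m, (mdeg m < e)%N -> g m = 0) ->
  forall m, (mdeg m < d + e)%N -> (f * g) m = 0.
Proof.
move=> f0 g0 m mde; apply: big1 => k km.
have [kd|dk] := ltnP (mdeg k) d; first by rewrite f0// mul0r.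
rewrite g0 ?mulr0//; have := congr1 mdeg (submK km); rewrite mdegD => mE.
by rewrite -(ltn_add2r (mdeg k)) mE (leq_trans mde)// addnC leq_add2l.
Qed.

Lemma fps_exp_order f (e : nat) : f mnm0 = 0 ->
  forall m, (mdeg m < e)%N -> (f ^+ e) m = 0.
Proof.
move=> f0; elim: e => [//|e IH] m me; rewrite exprS.
apply: (@fps_mul_order 1 e) => // k; rewrite ltnS leqn0 mdeg_eq0 => /eqP ->.
exact: f0.
Qed.

Lemma fps_prod_order (p : nat) (h : 'I_p -> fps K n) (k : multinom p) :
  (forall i, h i mnm0 = 0) ->
  forall m, (mdeg m < mdeg k)%N -> (\prod_(i < p) h i ^+ k i) m = 0.
Proof.
move=> h0; rewrite mdegE.
elim/big_rec2: _ => [//|i d f _ IH] m.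
exact/fps_mul_order/IH/fps_exp_order.
Qed.

Lemma fps_substE (p : nat) (f : fps K p) (h : 'I_p -> fps K n) m (d : nat) :
  (forall i, h i mnm0 = 0) -> (mdeg m < d)%N ->
  fps_subst f h m =
  \sum_(k : bmultinom p d) f k * (\prod_(i < p) h i ^+ k i : fps K n) m.
Proof.
move=> h0 md; pose G k := f k * (\prod_(i < p) h i ^+ k i : fps K n) m.
rewrite /fps_subst/=.
rewrite (big_sub_widen (bmultinom p (mdeg m).+1 : subFinType _)
  (bmultinom p d : subFinType _) xpredT G) /=; last first.
  by move=> k kd; exact: leq_trans kd md.
rewrite big_rmcond//= => k; rewrite -leqNgt => mk.
by rewrite /G fps_prod_order ?mulr0.
Qed.

End FpsSubst.

(* Main.v *)
(* Write D = det F_y(w, g(w)). Weights lam_i >= 1 on the variables w_i can be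
   chosen so that the part of D of lowest weight p is a single monomial c w^a.
   Let h be the truncation of g to weight <= p and u = g - h. Expanding
   F(w, h + u) = 0 at h and multiplying by the adjugate of A = F_y(w, h) gives
     det A . u = - adj A . (F(w, h) + Q),   Q quadratic in u,
   where det A still has the initial part c w^a and adj A . F(w, h) has order
   at least 2p + 1. In the norms |f|_s = sum_b |f_b| s^(lam . b), truncated at a
   given weight, multiplication by w^a is exactly multiplication by s^p, so for
   s small the bound |u|_s <= theta r s^p at weight K propagates to weight
   K + 1, and u converges. *)
Require Import Defs.
From HB Require Import structures.
From mathcomp Require Import all_boot all_order all_algebra.
From mathcomp Require Import boolp classical_sets cardinality fsbigop.
From mathcomp Require Import reals ereal esum complex.
From mathcomp Require Import -(notations) mpoly.
From mathcomp Require Import ring lra.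
From mathcomp Require finmap.

Set Implicit Arguments.
Unset Strict Implicit.
Unset Printing Implicit Defensive.

Import Order.TTheory GRing.Theory Num.Theory.

Local Open Scope ring_scope.

(** * Modules of power series and weighted orders *)

Section FpsModule.
Context (K : comNzRingType) (n : nat).
Implicit Types (f g : fps K n) (c : K).

Definition fps_scale c f : fps K n := Fps (fun b => c * f b).

Lemma fps_scaleA c c' f : fps_scale c (fps_scale c' f) = fps_scale (c * c') f.
Proof. by apply: fpsP => b /=; rewrite mulrA. Qed.
Lemma fps_scale1 : left_id 1 fps_scale.
Proof. by move=> f; apply: fpsP => b /=; rewrite mul1r. Qed.
Lemma fps_scaleDr : right_distributive fps_scale +%R.
Proof. by move=> c f g; apply: fpsP => b /=; rewrite mulrDr. Qed.
Lemma fps_scaleDl f : {morph fps_scale^~ f : c c' / c + c'}.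
Proof. by move=> c c'; apply: fpsP => b /=; rewrite mulrDl. Qed.

HB.instance Definition _ := GRing.Zmodule_isLmodule.Build K (fps K n)
  fps_scaleA fps_scale1 fps_scaleDr fps_scaleDl.

Lemma fps_scaleAl c f g : c *: (f * g) = c *: f * g.
Proof.
by apply: fpsP => b /=; rewrite mulr_sumr; apply: eq_bigr => k _; rewrite mulrA.
Qed.

HB.instance Definition _ := GRing.Lmodule_isLalgebra.Build K (fps K n)
  fps_scaleAl.

Lemma fps_coefD f g b : (f + g) b = f b + g b. Proof. by []. Qed.
Lemma fps_coefN f b : (- f) b = - f b. Proof. by []. Qed.
Lemma fps_coefB f g b : (f - g) b = f b - g b. Proof. by []. Qed.
Lemma fps_coefZ c f b : (c *: f) b = c * f b. Proof. by []. Qed.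
Lemma fps_coef0 b : (0 : fps K n) b = 0. Proof. by []. Qed.

Lemma fps_coef_sum (I : Type) (r : seq I) (P : pred I) (F : I -> fps K n) b :
  (\sum_(i <- r | P i) F i) b = \sum_(i <- r | P i) F i b.
Proof. exact: (big_morph (fun f : fps K n => f b)). Qed.

Lemma fps_coefMn f k b : (f *+ k) b = f b *+ k.
Proof. by elim: k => [|k IH] //; rewrite !mulrS fps_coefD IH. Qed.

Definition fps_mono (a : multinom n) : fps K n := Fps (fun b => (b == a)%:R).

End FpsModule.

(** * Weights of multi-indices and the filtration by weighted order *)

Section Weights.
Context (n : nat) (lam : 'I_n -> nat).

Definition wt (b : multinom n) : nat := \sum_(i < n) lam i * b i.

Lemma wtD a b : wt (mnm_add a b) = (wt a + wt b)%N.
Proof.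
by rewrite /wt -big_split/=; apply: eq_bigr => i _; rewrite mnmDE mulnDr.
Qed.

Lemma wt0 : wt mnm0 = 0%N.
Proof. by rewrite /wt big1// => i _; rewrite mnm0E muln0. Qed.

Lemma wt1 i : wt (mnm1 i) = lam i.
Proof.
rewrite /wt (bigD1 i)//= mnm1E eqxx muln1 big1 ?addn0// => j ji.
by rewrite mnm1E eq_sym (negbTE ji) muln0.
Qed.

(** Enumerating by total degree at most [K] before filtering loses nothing when all weights are
    positive, since the weight then bounds the degree; see [mem_wset]. *)
Definition wset (K : nat) : seq (multinom n) :=
  [seq b <- [seq bmnm b | b : bmultinom n K.+1] | (wt b <= K)%N].

Lemma wset_uniq K : uniq (wset K).
Proof.
rewrite filter_uniq// map_inj_uniq ?enum_uniq//; exact: val_inj.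
Qed.

Hypothesis lam_gt0 : forall i, (0 < lam i)%N.

Lemma mdeg_le_wt b : (mdeg b <= wt b)%N.
Proof.
by rewrite mdegE leq_sum// => i _; rewrite leq_pmull.
Qed.

Lemma mem_wset K b : (b \in wset K) = (wt b <= K)%N.
Proof.
rewrite /wset mem_filter; case: leqP => //= bK.
have bd : (mdeg b < K.+1)%N by rewrite ltnS (leq_trans _ bK)// mdeg_le_wt.
by apply/mapP; exists (BMultinom bd) => //; rewrite mem_enum.
Qed.

Context (K : comNzRingType).
Implicit Types (f g : fps K n).

(** Summands of [b] weigh no more than [b], and [k] determines [l] in $b = k + l$. The range of
    summation no longer depends on [b], so that sums over [b] can be exchanged with it. *)
Lemma fps_mul_wset f g M b : (wt b <= M)%N ->
  (f * g) b = \sum_(k <- wset M) \sum_(l <- wset M)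
    (f k * g l) *+ (b == mnm_add k l).
Proof.
move=> bM.
have kle k l : b = mnm_add k l -> lem k b /\ l = mnm_sub b k.
  move=> ->; split; first by apply/mnm_lepP => i; rewrite mnmDE leq_addr.
  by rewrite addmC addmK.
transitivity (\sum_(k <- wset M | lem k b) f k * g (mnm_sub b k)).
  transitivity (\sum_(k <- [seq bmnm k | k : bmultinom n (mdeg b).+1] | lem k b)
     f k * g (mnm_sub b k)); first by rewrite big_map big_enum_cond.
  rewrite -big_filter -[RHS]big_filter; apply/perm_big/uniq_perm.
  - by rewrite filter_uniq// map_inj_uniq ?enum_uniq//; exact: val_inj.
  - by rewrite filter_uniq// wset_uniq.
  move=> k; rewrite [LHS]mem_filter [RHS]mem_filter; case: (boolP (lem k b)) => //= kb.
  have kwb : (wt k <= wt b)%N by rewrite -(submK kb) wtD leq_addl.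
  have kdb : (mdeg k <= mdeg b)%N by rewrite -(submK kb) mdegD leq_addl.
  rewrite mem_wset (leq_trans kwb bM); apply/mapP.
  by exists (BMultinom (bound := (mdeg b).+1) (bmnm := k) kdb) => //; rewrite mem_enum.
rewrite big_mkcond; apply: eq_bigr => k _.
case: ifPn => [kb|kb]; last first.
  rewrite big1// => l _; case: eqP => // /kle[kb']; by rewrite kb' in kb.
have mb : mnm_sub b k \in wset M.
  by rewrite mem_wset (leq_trans _ bM)// -{2}(submK kb) wtD leq_addr.
rewrite (bigD1_seq (mnm_sub b k)) ?wset_uniq//= addmC (submK kb) eqxx big1 ?addr0//.
by move=> l lb; case: eqP => // /kle[_] le; rewrite le eqxx in lb.
Qed.

Definition wtord (d : nat) f := forall b, (wt b < d)%N -> f b = 0.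

Lemma wtord_le d e f : (d <= e)%N -> wtord e f -> wtord d f.
Proof. by move=> de fe b bd; apply: fe; apply: leq_trans de. Qed.

Lemma wtord_0 f : wtord 0 f. Proof. by []. Qed.

Lemma wtordD d f g : wtord d f -> wtord d g -> wtord d (f + g).
Proof. by move=> fd gd b bd; rewrite fps_coefD fd// gd// addr0. Qed.

Lemma wtordN d f : wtord d f -> wtord d (- f).
Proof. by move=> fd b bd; rewrite fps_coefN fd// oppr0. Qed.

Lemma wtordB d f g : wtord d f -> wtord d g -> wtord d (f - g).
Proof. by move=> fd gd; apply/wtordD/wtordN. Qed.

Lemma wtordZ d c f : wtord d f -> wtord d (c *: f).
Proof. by move=> fd b bd; rewrite fps_coefZ fd// mulr0. Qed.

Lemma wtord_sum d (I : Type) (r : seq I) (P : pred I) (F : I -> fps K n) :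
  (forall i, P i -> wtord d (F i)) -> wtord d (\sum_(i <- r | P i) F i).
Proof. by move=> Fd; elim/big_ind: _ => //; exact: wtordD. Qed.

Lemma wtordM d e f g : wtord d f -> wtord e g -> wtord (d + e) (f * g).
Proof.
move=> fd ge b bde; rewrite (fps_mul_wset _ _ (leqnn _)).
rewrite big1// => k _; rewrite big1// => l _; case: eqP => // bE.
have [kd|dk] := ltnP (wt k) d; first by rewrite fd// mul0r mul0rn.
rewrite ge ?mulr0 ?mul0rn// -(ltn_add2l (wt k)) -wtD -bE (leq_trans bde)//.
by rewrite leq_add2r.
Qed.

Lemma wtordMr d f g : wtord d f -> wtord d (f * g).
Proof. by move=> fd; rewrite -[d]addn0; apply: wtordM. Qed.

Lemma wtordMl d f g : wtord d g -> wtord d (f * g).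
Proof. by move=> fd; rewrite -[d]add0n; apply: wtordM. Qed.

Lemma fps_mono_coefM a f b : (fps_mono K a * f) (mnm_add a b) = f b.
Proof.
rewrite (fps_mul_wset _ _ (leqnn _)) (bigD1_seq a) ?wset_uniq//=; last first.
  by rewrite mem_wset wtD leq_addr.
rewrite (bigD1_seq b) ?wset_uniq//=; last by rewrite mem_wset wtD leq_addl.
rewrite !eqxx mul1r [X in _ + X + _]big1 ?addr0; last first.
  move=> c cb; case: eqP => // /addmI bc; by rewrite bc eqxx in cb.
rewrite big1 ?addr0// => k ka; rewrite big1// => l _.
by rewrite (negbTE ka) mul0r mul0rn.
Qed.

End Weights.

(** * Truncated weighted norms *)

Section NormC.
Context (R : rcfType).
Implicit Types (x y : R[i]).

Lemma normc_ge0 x : 0 <= Normc.normc x.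
Proof. by case: x => a b; exact: sqrtr_ge0. Qed.

Lemma normc_sum (I : Type) (r : seq I) (P : pred I) (F : I -> R[i]) :
  Normc.normc (\sum_(i <- r | P i) F i) <= \sum_(i <- r | P i) Normc.normc (F i).
Proof.
elim/big_rec2: _ => [|i y x _ xy]; first by rewrite Normc.normc0.
by rewrite (le_trans (le_normcD _ _))// lerD2l.
Qed.

Lemma normcX x k : Normc.normc (x ^+ k) = Normc.normc x ^+ k.
Proof.
by elim: k => [|k IH]; rewrite ?Normc.normc1// !exprS Normc.normcM IH.
Qed.

Lemma normc_prod (I : Type) (r : seq I) (P : pred I) (F : I -> R[i]) :
  Normc.normc (\prod_(i <- r | P i) F i) = \prod_(i <- r | P i) Normc.normc (F i).
Proof. exact: (big_morph _ (@Normc.normcM R) (Normc.normc1 R)). Qed.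

Lemma normc_real (x : R) : 0 <= x -> Normc.normc (x%:C)%C = x.
Proof. by move=> x0; rewrite /Normc.normc/= expr0n/= addr0 sqrtr_sqr ger0_norm. Qed.

End NormC.

(** Repetitions in [r'] are harmless, as they only add nonnegative terms; the proof finds [r] inside
    [undup r']. *)
Lemma ler_sum_subseq (R : numDomainType) (T : eqType) (r r' : seq T) (F : T -> R) :
  uniq r -> {subset r <= r'} -> (forall i, 0 <= F i) ->
  \sum_(i <- r) F i <= \sum_(i <- r') F i.
Proof.
move=> ru rr' F0.
rewrite [leRHS](bigID (mem r))/= -[leLHS]addr0 lerD ?sumr_ge0//.
rewrite -[leRHS]big_filter (perm_big [seq i <- undup r' | i \in r])/=; last first.
  apply: uniq_perm; rewrite ?filter_uniq ?undup_uniq//.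
  by move=> i; rewrite mem_filter mem_undup; case: (boolP (i \in r)) => //= /rr' ->.
rewrite !big_filter.
elim: r' {rr'} => [|i s IH]; first by rewrite !big_nil.
rewrite /= big_cons; case: ifPn => [_|_]; last rewrite big_cons.
  by rewrite (le_trans IH)//; case: ifP => // _; rewrite lerDr.
by case: ifP => // _; rewrite lerD2l.
Qed.

Section WeightedNorm.
Context (R : realType) (n : nat) (lam : 'I_n -> nat).
Hypothesis lam_gt0 : forall i, (0 < lam i)%N.
Implicit Types (f g : fps R[i] n) (s : R).
Local Notation wt := (wt lam).
Local Notation wset := (wset lam).
Local Notation wtord := (wtord lam).

(** The norm $|f|_s$ cut off at weight [M]: the sum stays finite for a series not yet known to
    converge, and allows induction on [M]. *)
Definition wnorm s (M : nat) f : R :=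
  \sum_(b <- wset M) Normc.normc (f b) * s ^+ wt b.

Lemma wnorm_ge0 s M f : 0 <= s -> 0 <= wnorm s M f.
Proof.
by move=> s0; apply: sumr_ge0 => b _; rewrite mulr_ge0 ?normc_ge0 ?exprn_ge0.
Qed.

Lemma wnorm_le s M L f : 0 <= s -> (M <= L)%N -> wnorm s M f <= wnorm s L f.
Proof.
move=> s0 ML; apply: ler_sum_subseq; first exact: wset_uniq.
  by move=> b; rewrite !mem_wset// => /leq_trans; exact.
by move=> b; rewrite mulr_ge0 ?normc_ge0 ?exprn_ge0.
Qed.

Lemma wnorm_congr s M f g : (forall b, (wt b <= M)%N -> f b = g b) ->
  wnorm s M f = wnorm s M g.
Proof.
by move=> fg; apply: eq_big_seq => b; rewrite mem_wset// => /fg ->.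
Qed.

Lemma wnorm0 s M : wnorm s M 0 = 0.
Proof. by apply: big1 => b _; rewrite fps_coef0 Normc.normc0 mul0r. Qed.

Lemma wnorm_ord0 s M f : wtord M.+1 f -> wnorm s M f = 0.
Proof.
by move=> fM; rewrite -[RHS](wnorm0 s M); apply: wnorm_congr => b /fM ->.
Qed.

Lemma wnormD s M f g : 0 <= s -> wnorm s M (f + g) <= wnorm s M f + wnorm s M g.
Proof.
move=> s0; rewrite -big_split/=; apply: ler_sum => b _.
by rewrite -mulrDl ler_wpM2r ?exprn_ge0// le_normcD.
Qed.

Lemma wnormN s M f : wnorm s M (- f) = wnorm s M f.
Proof. by apply: eq_bigr => b _; rewrite fps_coefN normcN. Qed.

Lemma wnormB s M f g : 0 <= s -> wnorm s M (f - g) <= wnorm s M f + wnorm s M g.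
Proof. by move=> s0; rewrite -(wnormN _ _ g) wnormD. Qed.

Lemma wnormZ s M c f : wnorm s M (c *: f) = Normc.normc c * wnorm s M f.
Proof.
rewrite mulr_sumr; apply: eq_bigr => b _.
by rewrite fps_coefZ Normc.normcM mulrA.
Qed.

Lemma wnorm_sum s M (I : Type) (r : seq I) (P : pred I) (F : I -> fps R[i] n) :
  0 <= s -> wnorm s M (\sum_(i <- r | P i) F i) <= \sum_(i <- r | P i) wnorm s M (F i).
Proof.
move=> s0; elim/big_rec2: _ => [|i y x _ xy]; first by rewrite wnorm0.
by rewrite (le_trans (wnormD _ _ _ s0))// lerD2l.
Qed.

(* As g has order at least e, only the coefficients of f of weight at most
   M - e contribute (and symmetrically); this gain is what makes the bound on u
   at weight K determine the one at weight K + 1. *)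
Lemma wnormM_ord s M d e f g : 0 <= s -> wtord d f -> wtord e g ->
  wnorm s M (f * g) <= wnorm s (M - e) f * wnorm s (M - d) g.
Proof.
move=> s0 fd ge.
pose F k := Normc.normc (f k) * s ^+ wt k; pose G k := Normc.normc (g k) * s ^+ wt k.
have F0 k : 0 <= F k by rewrite mulr_ge0 ?normc_ge0 ?exprn_ge0.
have G0 k : 0 <= G k by rewrite mulr_ge0 ?normc_ge0 ?exprn_ge0.
pose S := [seq (k, l) | k <- wset M, l <- wset M].
pose T := [seq (k, l) | k <- wset (M - e), l <- wset (M - d)].
have Su : uniq S.
  by apply: allpairs_uniq; rewrite ?wset_uniq// => -[? ?] [? ?].
apply: (@le_trans _ _ (\sum_(b <- wset M) \sum_(kl <- S)
    (F kl.1 * G kl.2) *+ (b == mnm_add kl.1 kl.2))).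
  rewrite /wnorm big_seq [leRHS]big_seq; apply: ler_sum => b; rewrite mem_wset// => bM.
  rewrite (fps_mul_wset lam_gt0 _ _ bM).
  have -> : \sum_(k <- wset M) \sum_(l <- wset M)
      (f k * g l) *+ (b == mnm_add k l) =
    \sum_(kl <- S) (f kl.1 * g kl.2) *+ (b == mnm_add kl.1 kl.2).
    by rewrite big_allpairs.
  apply: le_trans (ler_wpM2r _ (normc_sum _ _ _)) _; first by rewrite exprn_ge0.
  rewrite mulr_suml; apply: ler_sum => -[k l] _ /=.
  case: eqP => [->|_]; last by rewrite !mulr0n Normc.normc0 mul0r.
  by rewrite !mulr1n Normc.normcM wtD exprD /F /G mulrACA.
rewrite exchange_big/=.
have -> : wnorm s (M - e) f * wnorm s (M - d) g = \sum_(kl <- T) F kl.1 * G kl.2.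
  by rewrite big_allpairs mulr_suml; apply: eq_bigr => k _; rewrite mulr_sumr.
(* Outside [P] every term vanishes. Inside [P], the weight of [k] is at most [M - wt l], hence at
   most [M - e], and symmetrically for [l], so the pair lies in [T]. *)
pose P kl := [&& (d <= wt kl.1)%N, (e <= wt kl.2)%N & (wt kl.1 + wt kl.2 <= M)%N].
rewrite (bigID P)/= [X in _ + X]big1 ?addr0; last first.
  move=> [k l]; rewrite /P/= => nP.
  have [kd|dk] := ltnP (wt k) d.
    by rewrite big1// => b _; rewrite /F fd// Normc.normc0 !mul0r mul0rn.
  have [ke|ek] := ltnP (wt l) e.
    by rewrite big1// => b _; rewrite /G ge// Normc.normc0 !(mul0r,mulr0) mul0rn.
  rewrite dk ek/= -ltnNge in nP.
  rewrite big1_seq// => b /=; rewrite mem_wset// => bM.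
  by case: eqP bM => // ->; rewrite wtD leqNgt nP.
apply: (@le_trans _ _ (\sum_(kl <- S | P kl) F kl.1 * G kl.2)).
  apply: ler_sum => -[k l] _ /=.
  (* A pair feeds at most one coefficient of the product, as [wset M] has no repetition. *)
  rewrite sumrMnr (_ : (\sum_(i <- wset M) _)%N = count_mem (mnm_add k l) (wset M)).
    rewrite count_uniq_mem ?wset_uniq//; case: (_ \in _); rewrite ?mulr1n//.
    by rewrite mulr0n mulr_ge0.
  by rewrite -sum1_count [RHS]big_mkcond/=; apply: eq_bigr => b _; case: eqP.
rewrite -[leLHS]big_filter; apply: ler_sum_subseq; first by rewrite filter_uniq.
  move=> [k l]; rewrite mem_filter => /andP[/and3P[/= dk el kl _]].
  apply: allpairs_f; rewrite mem_wset//.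
    by apply: leq_trans (leq_sub2l M el); rewrite -(addnK (wt l) (wt k)) leq_sub2r.
  by apply: leq_trans (leq_sub2l M dk); rewrite -(addKn (wt k) (wt l)) leq_sub2r.
by move=> [k l]; exact: mulr_ge0.
Qed.

Lemma wnormM s M f g : 0 <= s ->
  wnorm s M (f * g) <= wnorm s M f * wnorm s M g.
Proof.
move=> s0; rewrite -[in leRHS](subn0 M).
by apply: wnormM_ord => //; exact: wtord_0.
Qed.

Lemma wnorm1 s M : wnorm s M 1 <= 1.
Proof.
rewrite /wnorm (bigD1_seq mnm0) ?wset_uniq//=; last by rewrite mem_wset// wt0.
rewrite eqxx Normc.normc1 mul1r wt0 expr0 big1 ?addr0// => b b0.
by rewrite (negbTE b0) Normc.normc0 mul0r.
Qed.

(** Passing from [s0] to [s] multiplies the term of weight $k \ge d$ by $(s/s_0)^k \le (s/s_0)^d$.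
    This turns orders of vanishing into powers of [s]. *)
Lemma wnorm_scale s s0 M d f : 0 <= s -> s <= s0 -> 0 < s0 -> wtord d f ->
  wnorm s M f <= (s / s0) ^+ d * wnorm s0 M f.
Proof.
move=> sge ss0 s0gt fd; rewrite mulr_sumr; apply: ler_sum => b _.
have [bd|db] := ltnP (wt b) d; first by rewrite fd// Normc.normc0 !mul0r mulr0.
rewrite [leRHS]mulrCA ler_wpM2l ?normc_ge0// -(subnK db) !exprD.
rewrite [leRHS]mulrCA -exprMn divfK ?gt_eqF//.
by rewrite ler_wpM2r ?exprn_ge0// lerXn2r ?nnegrE// ltW.
Qed.

(** Multiplication by $w^a$ moves the coefficients injectively and raises weights by [wt a]. Read
    from right to left, the inequality divides by the initial monomial. *)
Lemma wnorm_mono_ge s M a f : 0 <= s ->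
  s ^+ wt a * wnorm s M f <= wnorm s (M + wt a) (fps_mono _ a * f).
Proof.
move=> s0.
have -> : s ^+ wt a * wnorm s M f = \sum_(b <- [seq mnm_add a b | b <- wset M])
   Normc.normc ((fps_mono _ a * f) b) * s ^+ wt b.
  rewrite big_map mulr_sumr; apply: eq_bigr => b _.
  by rewrite (fps_mono_coefM lam_gt0) wtD exprD mulrCA.
apply: ler_sum_subseq.
- by rewrite map_inj_uniq ?wset_uniq//; exact: addmI.
- by move=> c /mapP[b]; rewrite !mem_wset// => bM ->; rewrite wtD addnC leq_add2r.
- by move=> b; rewrite mulr_ge0 ?normc_ge0 ?exprn_ge0.
Qed.

(** A bound uniform in the truncation; for positive [s] this amounts to absolute convergence at the
    point with coordinates $s^{\lambda_i}$. *)
Definition wbounded s f := exists C, forall M, wnorm s M f <= C.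

Lemma wboundedD s f g : 0 <= s -> wbounded s f -> wbounded s g -> wbounded s (f + g).
Proof.
move=> s0 [C fC] [D gD]; exists (C + D) => M.
by rewrite (le_trans (wnormD _ _ _ s0))// lerD.
Qed.

Lemma wboundedN s f : wbounded s f -> wbounded s (- f).
Proof. by move=> [C fC]; exists C => M; rewrite wnormN. Qed.

Lemma wboundedM s f g : 0 <= s -> wbounded s f -> wbounded s g -> wbounded s (f * g).
Proof.
move=> s0 [C fC] [D gD]; exists (C * D) => M.
by rewrite (le_trans (wnormM _ _ _ s0))// ler_pM ?wnorm_ge0.
Qed.

Lemma wbounded0 s : wbounded s 0.
Proof. by exists 0 => M; rewrite wnorm0. Qed.

Lemma wbounded1 s : wbounded s 1.
Proof. by exists 1 => M; exact: wnorm1. Qed.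

Lemma wboundedZ s c f : wbounded s f -> wbounded s (c *: f).
Proof.
move=> [C fC]; exists (Normc.normc c * C) => M.
by rewrite wnormZ ler_wpM2l ?normc_ge0.
Qed.

Lemma wbounded_sum s (I : Type) (r : seq I) (P : pred I) (F : I -> fps R[i] n) :
  0 <= s -> (forall i, P i -> wbounded s (F i)) -> wbounded s (\sum_(i <- r | P i) F i).
Proof.
move=> s0 FB; elim/big_ind: _ => //; first exact: wbounded0.
by move=> f g; exact: wboundedD.
Qed.

Lemma wbounded_prod s (I : Type) (r : seq I) (P : pred I) (F : I -> fps R[i] n) :
  0 <= s -> (forall i, P i -> wbounded s (F i)) -> wbounded s (\prod_(i <- r | P i) F i).
Proof.
move=> s0 FB; elim/big_ind: _ => //; first exact: wbounded1.
by move=> f g; exact: wboundedM.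
Qed.

Lemma wbounded_det s m (A : 'M[fps R[i] n]_m) : 0 <= s ->
  (forall i j, wbounded s (A i j)) -> wbounded s (\det A).
Proof.
move=> s0 AB; apply: wbounded_sum => // p _; apply: wboundedM => //.
  elim: (nat_of_bool _) => [|k IH]; first by rewrite expr0; exact: wbounded1.
  by rewrite exprS mulN1r; exact: wboundedN.
by apply: wbounded_prod.
Qed.

Lemma wbounded_adj s m (A : 'M[fps R[i] n]_m) i j : 0 <= s ->
  (forall i j, wbounded s (A i j)) -> wbounded s ((\adj A) i j).
Proof.
move=> s0 AB; rewrite mxE /cofactor; apply: wboundedM => //.
  elim: (_ + _)%N => [|k IH]; first by rewrite expr0; exact: wbounded1.
  by rewrite exprS mulN1r; exact: wboundedN.
by apply: wbounded_det => // k l; rewrite !mxE.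
Qed.

Lemma wbounded_le s s0 f : 0 <= s -> s <= s0 -> 0 < s0 -> wbounded s0 f -> wbounded s f.
Proof.
move=> sge ss0 s0gt [C fC]; exists C => M.
have := @wnorm_scale s s0 M 0 f sge ss0 s0gt (@wtord_0 _ _ _ _).
by rewrite expr0 mul1r => /le_trans; exact.
Qed.

End WeightedNorm.

(** * First-order expansion of a substitution *)

(** Induction on the total degree: a nonzero multi-index has a positive entry, which can be lowered
    by one. Monomials are thus built one factor at a time. *)
Lemma mnm_ind_deg (p : nat) (P : multinom p -> Prop) :
  P mnm0 -> (forall k i, P k -> P (mnm_add k (mnm1 i))) -> forall k, P k.
Proof.
move=> P0 PS k; have [d] := ubnP (mdeg k); elim: d k => // d IH k kd.
have [->//|k0] := eqVneq k mnm0.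
have [i ki] : exists i, k i != 0%N.
  apply/existsP; rewrite -negb_forall; apply: contra k0 => /forallP k0.
  by apply/eqP/mnmP => i; rewrite mnm0E; apply/eqP/k0.
have ik : lem (mnm1 i) k.
  by apply/mnm_lepP => j; rewrite mnm1E; case: eqP => // <-; rewrite lt0n.
rewrite -(submK ik); apply/PS/IH.
by move: kd; rewrite -{1}(submK ik) mdegD mdeg1 addn1.
Qed.

Section Monomials.
Context (A : comNzRingType) (p : nat).
Implicit Types (y v : 'I_p -> A) (k : multinom p).

Definition ypow y k : A := \prod_(i < p) y i ^+ k i.

(** The differential of $y \mapsto y^k$ applied to [v]. If [k i] is zero, [mnm_sub] truncates, but
    the multiplicity [k i] removes that term. *)
Definition ylin y v k : A :=
  \sum_(i < p) (ypow y (mnm_sub k (mnm1 i)) * v i) *+ k i.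

Definition yrem y v k : A :=
  ypow (fun i => y i + v i) k - ypow y k - ylin y v k.

Lemma ypow0 y : ypow y mnm0 = 1.
Proof. by apply: big1 => i _; rewrite mnm0E. Qed.

Lemma ypowS y k j : ypow y (mnm_add k (mnm1 j)) = ypow y k * y j.
Proof.
rewrite /ypow [in RHS](bigD1 j)//= (bigD1 j)//= mnmDE mnm1E eqxx addn1 exprSr.
rewrite -!mulrA; congr (_ * _); rewrite mulrC; congr (_ * _).
by apply: eq_bigr => i ij; rewrite mnmDE mnm1E eq_sym (negbTE ij) addn0.
Qed.

Lemma ylin0 y v : ylin y v mnm0 = 0.
Proof. by apply: big1 => i _; rewrite mnm0E. Qed.

(** The product rule for $y^k y_j$. *)
Lemma ylinS y v k j :
  ylin y v (mnm_add k (mnm1 j)) = ylin y v k * y j + ypow y k * v j.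
Proof.
rewrite /ylin (bigD1 j)//= [in RHS](bigD1 j)//= mulrDl.
rewrite addmK mnmDE mnm1E eqxx addn1 mulrS -!addrA addrC -addrA; congr (_ + _).
  rewrite -mulrnAl; case kj : (k j) => [|q]; first by rewrite !mulr0n !mul0r.
  have jk : lem (mnm1 j) k.
    by apply/mnm_lepP => i; rewrite mnm1E; case: eqP => // <-; rewrite kj.
  by rewrite -[in LHS](submK jk) ypowS -!mulrnAl mulrAC.
congr (_ + _); rewrite mulr_suml; apply: eq_bigr => i ij.
rewrite mnmDE mnm1E eq_sym (negbTE ij) addn0 mulrnAl.
case ki : (k i) => [|q]; first by rewrite !mulr0n.
have ik : lem (mnm1 i) k.
  by apply/mnm_lepP => l; rewrite mnm1E; case: eqP => // <-; rewrite ki.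
rewrite [mnm_add k _]addmC -addmBA// addmC ypowS; congr (_ *+ _).
by rewrite mulrAC.
Qed.

Lemma yrem0 y v : yrem y v mnm0 = 0.
Proof. by rewrite /yrem !ypow0 ylin0 subr0 subrr. Qed.

(** Expanding $(y+v)^k (y_j + v_j)$ creates a single new term, the product of the linear part with
    $v_j$; this is why the remainder is quadratic in [v]. *)
Lemma yremS y v k j : yrem y v (mnm_add k (mnm1 j)) =
  yrem y v k * y j + yrem y v k * v j + ylin y v k * v j.
Proof. by rewrite /yrem !ypowS ylinS; ring. Qed.

End Monomials.

Lemma wt_mdeg (p : nat) (k : multinom p) : wt (fun=> 1%N) k = mdeg k.
Proof. by rewrite mdegE; apply: eq_bigr => i _; rewrite mul1n. Qed.

Section Substitution.
Context (K : comNzRingType) (n p : nat) (lam : 'I_n -> nat).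
Hypothesis lam_gt0 : forall i, (0 < lam i)%N.
Implicit Types (F : fps K p) (y v z : 'I_p -> fps K n) (f g : fps K n).
Local Notation wtord := (wtord lam).
Local Notation degset := (wset (fun _ : 'I_p => 1%N)).

Let mem_degset M k : (k \in degset M) = (mdeg k <= M)%N.
Proof. by rewrite mem_wset// wt_mdeg. Qed.

Lemma wtord1P f : f mnm0 = 0 <-> wtord 1 f.
Proof.
split=> [f0 b|/(_ mnm0) ->//]; last by rewrite wt0.
rewrite ltnS leqn0 => /eqP b0; have := mdeg_le_wt lam_gt0 b.
by rewrite b0 leqn0 mdeg_eq0 => /eqP ->.
Qed.

(** As the [y i] have no constant term, $y^k$ starts in degree at least $|k|$, and weight dominates
    degree: monomials with $|k| > L$ cannot reach weight [M]. *)
Lemma fps_subst_trunc F y L M : (M <= L)%N -> (forall i, y i mnm0 = 0) ->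
  wtord M.+1 (fps_subst F y - \sum_(k <- degset L) F k *: ypow y k).
Proof.
move=> ML y0 b bM; rewrite fps_coefB.
rewrite (@fps_substE _ _ _ _ _ _ L.+1)//; last first.
  by rewrite (leq_ltn_trans (mdeg_le_wt lam_gt0 b))// (leq_trans bM).
apply/eqP; rewrite subr_eq0; apply/eqP; rewrite fps_coef_sum.
transitivity (\sum_(k <- [seq bmnm k | k : bmultinom p L.+1]) F k * ypow y k b).
  by rewrite big_map big_enum.
apply/perm_big/uniq_perm; rewrite ?wset_uniq//.
  by rewrite map_inj_uniq ?enum_uniq//; exact: val_inj.
move=> k; rewrite mem_degset; apply/mapP/idP => [[[k' kL] _ ->]//|kL].
by exists (BMultinom (bound := L.+1) (bmnm := k) kL) => //; rewrite mem_enum.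
Qed.

(** Reindexing by $k \mapsto k + e_i$, which raises the degree bound by one; the indices missed have
    [k i] equal to zero and contribute nothing. *)
Lemma deriv_trunc F y L i :
  \sum_(k <- degset L) fps_deriv i F k *: ypow y k =
  \sum_(k <- degset L.+1) F k *: (ypow y (mnm_sub k (mnm1 i)) *+ k i).
Proof.
rewrite [RHS](bigID (fun k : multinom p => k i == 0%N))/=.
rewrite [X in _ = X + _]big1 ?add0r; last first.
  by move=> k /eqP ->; rewrite mulr0n scaler0.
rewrite -[RHS]big_filter.
transitivity (\sum_(k <- [seq mnm_add k (mnm1 i) | k <- degset L])
   F k *: (ypow y (mnm_sub k (mnm1 i)) *+ k i)).
  rewrite big_map; apply: eq_bigr => k _ /=.
  rewrite addmK mnmDE mnm1E eqxx addn1; apply: fpsP => b.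
  by rewrite !fps_coefZ fps_coefMn mulrnAl mulrnAr.
apply/perm_big/uniq_perm.
- by rewrite map_inj_uniq ?wset_uniq//; exact: (can_inj (addmK _)).
- by apply: filter_uniq; exact: wset_uniq.
move=> k; rewrite [RHS]mem_filter mem_degset; apply/mapP/andP => [[l]|[ki kL]].
  rewrite mem_degset => lL ->; rewrite mnmDE mnm1E eqxx addn1; split=> //.
  by rewrite mdegD mdeg1 addn1 ltnS.
have ik : lem (mnm1 i) k.
  by apply/mnm_lepP => j; rewrite mnm1E; case: eqP => // <-; rewrite lt0n.
exists (mnm_sub k (mnm1 i)); rewrite ?submK// mem_degset.
by move: kL; rewrite -{1}(submK ik) mdegD mdeg1 addn1.
Qed.

(** The remainder of the first-order Taylor expansion of [F] at [y] with increment [v]. *)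
Definition subst_rem F y v : fps K n :=
  fps_subst F (fun i => y i + v i) - fps_subst F y -
  \sum_(i < p) fps_subst (fps_deriv i F) y * v i.

(** By linearity in [F]. The degree bound is [M.+1] because derivatives cut at degree [M] come from
    [F] cut at degree [M.+1]; all three truncations are exact up to weight [M]. *)
Lemma subst_rem_trunc F y v M : (forall i, y i mnm0 = 0) ->
  (forall i, v i mnm0 = 0) ->
  wtord M.+1 (subst_rem F y v - \sum_(k <- degset M.+1) F k *: yrem y v k).
Proof.
move=> y0 v0.
pose S G z L := \sum_(k <- degset L) G k *: ypow z k : fps K n.
have -> : \sum_(k <- degset M.+1) F k *: yrem y v k =
    S F (fun i => y i + v i) M.+1 - S F y M.+1 -
    \sum_(i < p) S (fps_deriv i F) y M * v i.
  have -> : \sum_(i < p) S (fps_deriv i F) y M * v i =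
      \sum_(k <- degset M.+1) F k *: ylin y v k.
    under eq_bigr => i _ do rewrite /S deriv_trunc mulr_suml.
    rewrite exchange_big/=; apply: eq_bigr => k _; rewrite scaler_sumr.
    by apply: eq_bigr => i _; rewrite -scalerAl mulrnAl.
  by rewrite -!sumrB; apply: eq_bigr => k _; rewrite -!scalerBr.
have -> : subst_rem F y v - (S F (fun i => y i + v i) M.+1 - S F y M.+1 -
    \sum_(i < p) S (fps_deriv i F) y M * v i) =
    (fps_subst F (fun i => y i + v i) - S F (fun i => y i + v i) M.+1) -
    (fps_subst F y - S F y M.+1) -
    \sum_(i < p) (fps_subst (fps_deriv i F) y - S (fps_deriv i F) y M) * v i.
  rewrite /subst_rem; under [in RHS]eq_bigr => i _ do rewrite mulrBl.
  by rewrite sumrB; ring.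
apply: wtordB; first apply: wtordB.
- by apply: fps_subst_trunc => // i; rewrite fps_coefD y0 v0 addr0.
- exact: fps_subst_trunc.
- by apply: wtord_sum => i _; apply: wtordMr => //; exact: fps_subst_trunc.
Qed.

Lemma wtord_ylin d y v k : (forall i, wtord d (v i)) -> wtord d (ylin y v k).
Proof.
move=> vd; elim/mnm_ind_deg: k => [|k i IH]; first by rewrite ylin0.
by rewrite ylinS; apply: wtordD; [exact: wtordMr|exact: wtordMl].
Qed.

Lemma wtord_yrem d y v k : (forall i, wtord d (v i)) -> wtord (d + d) (yrem y v k).
Proof.
move=> vd; elim/mnm_ind_deg: k => [|k i IH]; first by rewrite yrem0.
rewrite yremS; apply: wtordD; first by apply: wtordD; exact: wtordMr.
by apply: wtordM => //; exact: wtord_ylin.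
Qed.

Lemma wtord_subst_rem d F y v : (forall i, y i mnm0 = 0) ->
  (forall i, v i mnm0 = 0) -> (forall i, wtord d (v i)) ->
  wtord (d + d) (subst_rem F y v).
Proof.
move=> y0 v0 vd b bd.
have /(_ b (ltnSn _)) := @subst_rem_trunc F y v (wt lam b) y0 v0.
move/eqP; rewrite fps_coefB subr_eq0 => /eqP ->.
apply: wtord_sum bd => k _; apply: wtordZ; exact: wtord_yrem.
Qed.

(** Series of order at least [d] form an ideal. Products, and then monomials, substitutions and
    determinants, respect congruence modulo it, which allows replacing the solution by its
    truncation. *)
Lemma wtordM_sub d f f' g g' : wtord d (f - f') -> wtord d (g - g') ->
  wtord d (f * g - f' * g').
Proof.
move=> ff gg; have -> : f * g - f' * g' = (f - f') * g + f' * (g - g') by ring.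
by apply: wtordD; [exact: wtordMr|exact: wtordMl].
Qed.

Lemma wtord_ypow_sub d y z k : (forall i, wtord d (y i - z i)) ->
  wtord d (ypow y k - ypow z k).
Proof.
move=> yz; elim/mnm_ind_deg: k => [|k i IH]; first by rewrite !ypow0 subrr.
by rewrite !ypowS; apply: wtordM_sub.
Qed.

Lemma wtord_subst_sub d F y z : (forall i, y i mnm0 = 0) ->
  (forall i, z i mnm0 = 0) -> (forall i, wtord d (y i - z i)) ->
  wtord d (fps_subst F y - fps_subst F z).
Proof.
move=> y0 z0 yz b bd; rewrite fps_coefB.
have /(_ b (ltnSn _))/eqP := fps_subst_trunc F (leqnn (wt lam b)) y0.
rewrite fps_coefB subr_eq0 => /eqP ->.
have /(_ b (ltnSn _))/eqP := fps_subst_trunc F (leqnn (wt lam b)) z0.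
rewrite fps_coefB subr_eq0 => /eqP ->.
rewrite -fps_coefB -sumrB; apply: wtord_sum bd => k _; rewrite -scalerBr.
exact/wtordZ/wtord_ypow_sub.
Qed.

Lemma wtord_det_sub d m (A B : 'M[fps K n]_m) :
  (forall i j, wtord d (A i j - B i j)) -> wtord d (\det A - \det B).
Proof.
move=> AB; rewrite /determinant -sumrB; apply: wtord_sum => s _.
rewrite -mulrBr; apply: wtordMl => //.
elim/big_rec2: _ => [|i f g _ IH]; first by rewrite subrr.
exact: wtordM_sub.
Qed.

End Substitution.

(** * Norm estimates for substitutions, derivatives and Taylor remainders *)

Section SubstitutionNorm.
Context (R : realType) (n p : nat) (lam : 'I_n -> nat).
Hypothesis lam_gt0 : forall i, (0 < lam i)%N.
Implicit Types (s r x C : R) (F : fps R[i] p) (y v z : 'I_p -> fps R[i] n).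
Local Notation wtord := (wtord lam).
Local Notation one := (fun _ : 'I_p => 1%N).

Lemma wnorm_ypow s M r y k : 0 <= s -> 0 <= r ->
  (forall i, wnorm lam s M (y i) <= r) -> wnorm lam s M (ypow y k) <= r ^+ mdeg k.
Proof.
move=> s0 r0 yr; elim/mnm_ind_deg: k => [|k i IH].
  by rewrite ypow0 mdeg0 expr0 wnorm1.
rewrite ypowS mdegD mdeg1 addn1 exprSr (le_trans (wnormM _ _ _ _ s0))//.
by rewrite ler_pM ?wnorm_ge0.
Qed.

(** By submultiplicativity the norm of $y^k$ is at most $r^{|k|}$, so [F] at radius [r] is a
    majorant. *)
Lemma wnorm_subst s M r F y : 0 <= s -> 0 <= r ->
  (forall i, y i mnm0 = 0) -> (forall i, wnorm lam s M (y i) <= r) ->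
  wnorm lam s M (fps_subst F y) <= wnorm one r M F.
Proof.
move=> s0 r0 y0 yr.
rewrite (@wnorm_congr _ _ _ lam_gt0 _ _ _
  (\sum_(k <- wset one M) F k *: ypow y k)); last first.
  move=> b bM; have /(_ b) := fps_subst_trunc lam_gt0 F (leqnn M) y0.
  by rewrite ltnS bM fps_coefB => /(_ isT)/eqP; rewrite subr_eq0 => /eqP.
rewrite (le_trans (wnorm_sum _ _ _ _ _ s0))//; apply: ler_sum => k _.
by rewrite wnormZ wt_mdeg ler_wpM2l ?normc_ge0// wnorm_ypow.
Qed.

Lemma wbounded_subst s r F y : 0 <= s -> 0 <= r ->
  (forall i, y i mnm0 = 0) -> (forall i M, wnorm lam s M (y i) <= r) ->
  wbounded one r F -> wbounded lam s (fps_subst F y).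
Proof.
move=> s0 r0 y0 yr [C FC]; exists C => M; apply: le_trans (FC M).
by apply: wnorm_subst.
Qed.

(** Halving the radius absorbs the factor $k_i + 1 \le 2^{|k|}$ coming from the derivative; $r^{-1}$
    accounts for the shift of degree. *)
Lemma wbounded_deriv r F i : 0 < r -> wbounded one r F ->
  wbounded one (r / 2) (fps_deriv i F).
Proof.
move=> r0 [C FC]; exists (r^-1 * C) => M.
apply: le_trans (ler_wpM2l _ (FC M.+1)); last by rewrite invr_ge0 ltW.
pose G k := Normc.normc (F k) * r ^+ mdeg k.
apply: (@le_trans _ _
    (r^-1 * \sum_(k <- [seq mnm_add k (mnm1 i) | k <- wset one M]) G k)).
  rewrite big_map mulr_sumr; apply: ler_sum => k _ /=.
  rewrite /G mdegD mdeg1 addn1 wt_mdeg normcMn.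
  rewrite exprS mulrCA [_^-1 * _]mulrA mulVf ?gt_eqF// mul1r.
  rewrite mulrnAl -mulrnAr ler_wpM2l ?normc_ge0//.
  rewrite expr_div_n -mulrnAl.
  rewrite ler_pdivrMr ?exprn_gt0// -mulr_natr ler_wpM2l ?exprn_ge0 ?(ltW r0)//.
  rewrite -natrX ler_nat.
  have ki : (k i <= mdeg k)%N by rewrite mdegE (bigD1 i)//= leq_addr.
  by rewrite (leq_trans (ltn_expl (k i) (ltnSn 1)))// leq_exp2l.
rewrite ler_wpM2l ?invr_ge0 ?(ltW r0)//.
rewrite [leRHS](_ : _ = \sum_(k <- wset one M.+1) G k); last first.
  by apply: eq_bigr => k _; rewrite wt_mdeg.
apply: ler_sum_subseq.
- by rewrite map_inj_uniq ?wset_uniq//; exact: (can_inj (addmK _)).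
- move=> c /mapP[b]; rewrite !mem_wset// !wt_mdeg => bM ->.
  by rewrite mdegD mdeg1 addn1.
- by move=> k; rewrite mulr_ge0 ?normc_ge0 ?exprn_ge0 ?ltW.
Qed.

(** Joint induction through [ylinS] and [yremS]. The constants reproduce themselves since $2/4 + 1
    \le 2$ and $4/4 + 4x + 2 \le 4$. Knowing [v] up to weight [M] controls the remainder up to
    [M + d], because each [v i] is multiplied by a series of order at least [d]. *)
Lemma wnorm_yrem s M d r x y v k : 0 <= s -> 0 <= r -> 0 <= x -> x <= 4^-1 ->
  (forall i, wnorm lam s (M + d) (y i) <= r / 4) ->
  (forall i, wtord d (v i)) -> (forall i, wnorm lam s M (v i) <= x * r) ->
  wnorm lam s M (ylin y v k) <= 2 * r ^+ mdeg k * x /\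
  wnorm lam s (M + d) (yrem y v k) <= 4 * r ^+ mdeg k * x ^+ 2.
Proof.
move=> s0 r0 x0 x4 yr vd vx.
have yM i : wnorm lam s M (y i) <= r / 4.
  by rewrite (le_trans _ (yr i))// wnorm_le// leq_addr.
have PM l : wnorm lam s M (ypow y l) <= r ^+ mdeg l.
  apply: wnorm_ypow => // i; rewrite (le_trans (yM i))//.
  by rewrite ler_piMr// invf_le1 ?ler1n.
elim/mnm_ind_deg: k => [|k i [IHl IHr]].
  by rewrite ylin0 yrem0 !wnorm0; split; rewrite !mulr_ge0 ?exprn_ge0.
rewrite ylinS yremS mdegD mdeg1 addn1 (exprS r).
move: (PM k) (yM i) (yr i) (vx i) IHl IHr.
set q := r ^+ mdeg k => Pk yi yi' vi IHl IHr.
have q0 : 0 <= q by rewrite exprn_ge0.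
split.
  rewrite (le_trans (wnormD _ _ _ _ s0))//.
  apply: (@le_trans _ _ ((2 * q * x) * (r / 4) + q * (x * r))).
    by rewrite lerD// (le_trans (wnormM _ _ _ _ s0))// ler_pM ?wnorm_ge0.
  have h : 0 <= q * x * r by rewrite !mulr_ge0.
  rewrite [leLHS](_ : _ = 3 / 2 * (q * x * r)); last by field.
  by rewrite [leRHS](_ : _ = 2 * (q * x * r)); [lra|ring].
(* Both factors have order at least [d], so only their weights up to [M] enter. *)
have Lv : wnorm lam s (M + d) (ylin y v k * v i) <= (2 * q * x) * (x * r).
  rewrite (le_trans (wnormM_ord _ _ s0 (wtord_ylin (d := d) _ _ _ _) (vd i)))//.
  by rewrite addnK ler_pM ?wnorm_ge0.
have Qv : wnorm lam s (M + d) (yrem y v k * v i) <= (4 * q * x ^+ 2) * (x * r).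
  have Qd : wtord d (yrem y v k).
    by apply: wtord_le (wtord_yrem (d := d) _ _ _ _) => //; rewrite leq_addr.
  rewrite (le_trans (wnormM_ord _ _ s0 Qd (vd i)))//.
  rewrite addnK ler_pM ?wnorm_ge0// (le_trans _ IHr)// wnorm_le ?leq_addr//.
have Qy : wnorm lam s (M + d) (yrem y v k * y i) <= (4 * q * x ^+ 2) * (r / 4).
  by rewrite (le_trans (wnormM _ _ _ _ s0))// ler_pM ?wnorm_ge0.
rewrite (le_trans (wnormD _ _ _ _ s0))//.
rewrite (le_trans (lerD (wnormD _ _ _ _ s0) (lexx _)))//.
apply: (le_trans (lerD (lerD Qy Qv) Lv)).
have h : 0 <= q * x ^+ 2 * r by rewrite !mulr_ge0// exprn_ge0.
have h' : (q * x ^+ 2 * r) * x <= (q * x ^+ 2 * r) * 4^-1 by rewrite ler_wpM2l.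
rewrite (_ : 4 * q * x ^+ 2 * (r / 4) + 4 * q * x ^+ 2 * (x * r) +
  2 * q * x * (x * r) = 3 * (q * x ^+ 2 * r) + 4 * ((q * x ^+ 2 * r) * x)).
  by rewrite (_ : 4 * (r * q) * x ^+ 2 = 4 * (q * x ^+ 2 * r)); [lra|ring].
by field.
Qed.

(** Termwise from [wnorm_yrem]: the factors $r^{|k|}$ reassemble the norm of [F] at radius [r]. The
    bound is quadratic in [x] and reaches [d] weights beyond what is known of [v]. *)
Lemma wnorm_subst_rem s M d r x C F y v : 0 <= s -> 0 <= r -> 0 <= x -> x <= 4^-1 ->
  (forall i, y i mnm0 = 0) -> (forall i, v i mnm0 = 0) ->
  (forall i, wnorm lam s (M + d) (y i) <= r / 4) ->
  (forall i, wtord d (v i)) -> (forall i, wnorm lam s M (v i) <= x * r) ->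
  (forall L, wnorm one r L F <= C) ->
  wnorm lam s (M + d) (subst_rem F y v) <= 4 * C * x ^+ 2.
Proof.
move=> s0 r0 x0 x4 y0 v0 yr vd vx FC.
rewrite (@wnorm_congr _ _ _ lam_gt0 _ _ _
  (\sum_(k <- wset one (M + d).+1) F k *: yrem y v k)); last first.
  move=> b bM; have /(_ b) := subst_rem_trunc lam_gt0 F (M := (M + d)%N) y0 v0.
  by rewrite ltnS bM fps_coefB => /(_ isT)/eqP; rewrite subr_eq0 => /eqP.
rewrite (le_trans (wnorm_sum _ _ _ _ _ s0))//.
rewrite (_ : 4 * C * x ^+ 2 = C * (4 * x ^+ 2)); last by ring.
have c0 : 0 <= 4 * x ^+ 2 by rewrite mulr_ge0 ?exprn_ge0.
apply: le_trans (ler_wpM2r c0 (FC (M + d).+1)).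
rewrite mulr_suml; apply: ler_sum => k _.
rewrite wnormZ wt_mdeg -mulrA ler_wpM2l ?normc_ge0//.
have [_ /le_trans] := wnorm_yrem k s0 r0 x0 x4 yr vd vx; apply.
by rewrite [4 * _]mulrC -mulrA.
Qed.

End SubstitutionNorm.

(** * Choice of the weights; convergence and bounded norms *)

(** Uniqueness of base-[B] digits: reduction modulo [B] gives the lowest one, division by [B] the
    others. *)
Lemma digits_inj (B n : nat) (a b : 'I_n -> nat) :
  (forall i, a i < B)%N -> (forall i, b i < B)%N ->
  (\sum_(i < n) B ^ i * a i = \sum_(i < n) B ^ i * b i)%N -> a =1 b.
Proof.
elim: n a b => [|n IH] a b aB bB; first by move=> _ [].
have B0 : (0 < B)%N by apply: leq_ltn_trans (aB ord0).
have shift c : (\sum_(i < n.+1) B ^ i * c i =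
    (\sum_(i < n) B ^ i * c (lift ord0 i)) * B + c ord0)%N.
  rewrite big_ord_recl/= expn0 mul1n addnC big_distrl/=; congr (_ + _)%N.
  by apply: eq_bigr => i _; rewrite /bump add1n expnS [RHS]mulnC mulnA.
rewrite !shift => e.
have e0 : a ord0 = b ord0.
  by move/(congr1 (modn^~ B)): e; rewrite !modnMDl !modn_small.
have {}e : (\sum_(i < n) B ^ i * a (lift ord0 i) =
    \sum_(i < n) B ^ i * b (lift ord0 i))%N.
  by move/eqP: e; rewrite e0 eqn_add2r eqn_pmul2r// => /eqP.
move=> i; case: (unliftP ord0 i) => [k|] -> //.
by have := IH _ _ (fun i => aB (lift ord0 i)) (fun i => bB (lift ord0 i)) e k.
Qed.

(* The weights are M + B^i: the B^i separate the exponents of the lowest degree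
   d < B in the support of D, and a large M puts them below those of higher
   degree. *)
Lemma initial_monomial (K : comNzRingType) (n : nat) (D : fps K n) : D <> 0 ->
  exists (lam : 'I_n -> nat) (a : multinom n),
  [/\ forall i, (0 < lam i)%N, D a != 0 &
      forall b, D b != 0 -> b != a -> (wt lam a < wt lam b)%N].
Proof.
move=> D0; pose P d := `[< exists2 b, mdeg b = d & D b != 0 >].
have exP : exists d, P d.
  have [b Db] : exists b, D b != 0.
    apply/not_existsP => H; apply: D0; apply: fpsP => b; apply/eqP.
    by apply: contrapT => /negP /(H b).
  by exists (mdeg b); apply/asboolP; exists b.
case: (ex_minnP exP) => d /asboolP[b0 b0d Db0] dmin.
pose B := d.+1; pose mu b := wt (fun i : 'I_n => (B ^ i)%N) b.
have b0B : (mdeg b0 < B)%N by rewrite b0d.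
pose Q (b : bmultinom n B) := (mdeg b == d) && (D b != 0).
have Qb0 : Q (BMultinom b0B) by rewrite /Q/= b0d eqxx.
case: (arg_minnP (fun b : bmultinom n B => mu b) Qb0) => a /andP[/eqP ad Da] amin.
(* This exceeds [mu a], which is at most $B^n d$, so that one additional degree outweighs [mu a]. *)
pose M := (B ^ n * d).+1.
exists (fun i => M + B ^ i)%N, a; split => //.
have wtE b : wt (fun i : 'I_n => (M + B ^ i)%N) b = (M * mdeg b + mu b)%N.
  rewrite /wt /mu /wt mdegE big_distrr/= -big_split/=.
  by apply: eq_bigr => i _; rewrite mulnDl.
have muM : (mu a < M)%N.
  rewrite ltnS -ad mdegE big_distrr/=; apply: leq_sum => i _.
  by apply: leq_mul => //; apply: leq_pexp2l => //; exact: ltnW.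
move=> b Db ba; rewrite !wtE ad.
have db : (d <= mdeg b)%N by apply: dmin; apply/asboolP; exists b.
case: (ltngtP d (mdeg b)) db => // [db _|db _].
  rewrite (@leq_trans (M * d.+1))//; first by rewrite mulnS addnC ltn_add2r.
  by rewrite (leq_trans _ (leq_addr _ _))// leq_mul2l db orbT.
rewrite -db ltn_add2l.
have bB : (mdeg b < B)%N by rewrite -db.
have := amin (BMultinom bB); rewrite /Q/= -db eqxx Db => /(_ isT).
rewrite leq_eqVlt => /orP[/eqP mub|//].
case/negP: ba; apply/eqP/mnmP => i; apply/esym; move: i.
apply: (digits_inj (B := B)) mub => i; rewrite ltnS.
  by rewrite -ad mdegE (bigD1 i)//= leq_addr.
by rewrite db mdegE (bigD1 i)//= leq_addr.
Qed.

Section Convergence.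
Context (R : realType).

Lemma convergent_wbounded p (F : fps R[i] p) : fps_convergent F ->
  exists2 r : R, 0 < r & wbounded (fun=> 1%N) r F.
Proof.
move=> [r r0 Fr]; exists (r / 2); first by rewrite divr_gt0.
(* At this diagonal point of the open polydisc, the series of absolute values is the norm of [F] at
   radius [r / 2]. *)
pose z (i : 'I_p) : R[i] := ((r / 2)%:C)%C.
have nz i : Normc.normc (z i) = r / 2 by rewrite normc_real// divr_ge0// ltW.
have /Fr : forall i, Normc.normc (z i) < r by move=> i; rewrite nz; lra.
rewrite /summable; set S := esum _ _ => Sfin.
have coefE a : Normc.normc (F a * \prod_(i < p) z i ^+ a i) =
    Normc.normc (F a) * (r / 2) ^+ mdeg a.
  rewrite Normc.normcM normc_prod mdegE -prodrXr; congr (_ * _).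
  by apply: eq_bigr => i _; rewrite normcX nz.
exists (fine S) => M; rewrite -lee_fin fineK; last first.
  by rewrite ge0_fin_numE// esum_ge0.
apply: esum_ge; exists [set` wset (fun=> 1%N) M]%classic.
  by split => //; exact: finite_seq.
rewrite -fsbig_seq ?wset_uniq// /wnorm -sumEFin lee_sum// => a _.
by rewrite coefE wt_mdeg/= lee_fin ler_norm.
Qed.

(** With [L] the sum of the weights and [s <= 1], the bound $|z_i| < s^L \le s^{\lambda_i}$ gives
    $|z^b| \le s^{\lambda\cdot b}$; each finite partial sum is then below some truncated norm. *)
Lemma wbounded_convergent n (lam : 'I_n -> nat) s (f : fps R[i] n) :
  (forall i, 0 < lam i)%N -> 0 < s -> s <= 1 -> wbounded lam s f ->
  fps_convergent f.
Proof.
move=> lam0 s0 s1 [C fC]; pose L := (\sum_i lam i)%N.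
exists (s ^+ L); first exact: exprn_gt0.
move=> z zr; rewrite /summable; apply: (@le_lt_trans _ _ C%:E); last exact: ltry.
apply: ub_ereal_sup => _ [X [Xfin _] <-].
rewrite (fsbig_finite _ _ Xfin)/=.
set T := finmap.enum_fset _.
have Tu : uniq T by exact: finmap.fset_uniq.
pose M := (\max_(b <- T) wt lam b)%N.
apply: (@le_trans _ _ (\sum_(b <- T) Normc.normc (f b) * s ^+ wt lam b)%:E).
  rewrite -sumEFin; apply: lee_sum => b _; rewrite lee_fin.
  rewrite ger0_norm ?normc_ge0// Normc.normcM ler_wpM2l ?normc_ge0//.
  rewrite normc_prod /wt -prodrXr; apply: ler_prod => i _.
  rewrite normc_ge0 normcX exprM lerXn2r ?nnegrE ?normc_ge0 ?exprn_ge0 ?(ltW s0)//.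
  rewrite (le_trans (ltW (zr i)))// ler_wiXn2l ?(ltW s0)//.
  by rewrite /L (bigD1 i)//= leq_addr.
rewrite lee_fin (le_trans _ (fC M))//; apply: ler_sum_subseq => //.
  by move=> b bT; rewrite mem_wset// /M (big_rem b)//= leq_maxl.
by move=> b; rewrite mulr_ge0 ?normc_ge0 ?exprn_ge0 ?(ltW s0).
Qed.

Lemma uniform_bound (I : finType) (T : Type) (u : I -> T -> R) :
  (forall i, exists C, forall t, u i t <= C) ->
  exists2 C, 0 < C & forall i t, u i t <= C.
Proof.
move=> /fin_all_exists[C uC]; exists (1 + \sum_i `|C i|).
  by rewrite ltr_pwDl// sumr_ge0.
move=> i t; rewrite (le_trans (uC i t))// (bigD1 i)//=.
rewrite (le_trans (ler_norm _))// addrCA lerDl addr_ge0// sumr_ge0//.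
Qed.

(** The witness $(1 + \sum_i r_i^{-1})^{-1}$ lies below every $r_i$ and is positive even when [I] is
    empty. *)
Lemma uniform_radius (I : finType) (P : I -> R -> Prop) :
  (forall i, exists2 r, 0 < r & P i r) ->
  (forall i r t, 0 < t -> t <= r -> P i r -> P i t) ->
  exists2 r, 0 < r & forall i, P i r.
Proof.
move=> exr Pmon.
have /fin_all_exists[r rP] : forall i, exists r, 0 < r /\ P i r.
  by move=> i; have [r r0 Pr] := exr i; exists r.
have S0 : 0 <= \sum_i (r i)^-1.
  by apply: sumr_ge0 => i _; rewrite invr_ge0 ltW; case: (rP i).
exists (1 + \sum_i (r i)^-1)^-1; first by rewrite invr_gt0; lra.
move=> i; have [ri Pi] := rP i; apply: Pmon Pi; first by rewrite invr_gt0; lra.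
rewrite -[leRHS]invrK lef_pV2 ?posrE ?invr_gt0//; last lra.
rewrite (bigD1 i)//= addrCA lerDl addr_ge0// sumr_ge0// => k _.
by rewrite invr_ge0 ltW; case: (rP k).
Qed.

Lemma small_scalar (Z e b : R) : 0 <= Z -> 0 < e -> 0 < b ->
  exists t, [/\ 0 < t, t <= b & Z * t <= e].
Proof.
move=> Z0 e0 b0; have Z1 : 0 < Z + 1 by lra.
(* Dividing by [Z + 1] covers the case of a zero [Z]. *)
exists (Num.min b (e / (Z + 1))); split.
- by rewrite lt_min b0 divr_gt0.
- by rewrite ge_min lexx.
apply: (@le_trans _ _ (Z * (e / (Z + 1)))).
  by rewrite ler_wpM2l// ge_min lexx orbT.
rewrite mulrA ler_pdivrMr//; nra.
Qed.

Context (n : nat) (lam : 'I_n -> nat).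
Hypothesis lam_gt0 : forall i, (0 < lam i)%N.

Lemma wbounded_poly s (f : fps R[i] n) N : 0 <= s ->
  (forall b, (N < wt lam b)%N -> f b = 0) -> wbounded lam s f.
Proof.
move=> s0 fN; exists (wnorm lam s N f) => M.
rewrite /wnorm (bigID (fun b => wt lam b <= N)%N)/= [X in _ + X]big1 ?addr0; last first.
  by move=> b; rewrite -ltnNge => /fN ->; rewrite Normc.normc0 mul0r.
rewrite -[leLHS]big_filter; apply: ler_sum_subseq.
- by apply: filter_uniq; exact: wset_uniq.
- by move=> b; rewrite mem_filter !mem_wset// => /andP[].
- by move=> b; rewrite mulr_ge0 ?normc_ge0 ?exprn_ge0.
Qed.

(** Without constant term the order is at least 1, so the norm at [s] is at most [s] times the norm
    at 1. *)
Lemma small_radius p (y : 'I_p -> fps R[i] n) e : 0 < e ->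
  (forall i, y i mnm0 = 0) -> (forall i, wbounded lam 1 (y i)) ->
  exists s, [/\ 0 < s, s <= 1 & forall i M, wnorm lam s M (y i) <= e].
Proof.
move=> e0 y0 yb.
have [C C0 yC] := uniform_bound (u := fun i M => wnorm lam 1 M (y i)) yb.
have [s [s0 s1 Cs]] := small_scalar (ltW C0) e0 ltr01.
exists s; split=> // i M.
have y1 : wtord lam 1 (y i) by apply/(wtord1P lam_gt0).
have := wnorm_scale M (ltW s0) s1 ltr01 y1.
rewrite divr1 expr1 => /le_trans; apply; apply: le_trans Cs.
by rewrite mulrC ler_wpM2r// ltW.
Qed.

End Convergence.

(** * The iteration *)

(** Cramer's rule in a form free of division. *)
Lemma adj_solve (A : comNzRingType) (m : nat) (M : 'M[A]_m) (u b : 'I_m -> A) :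
  (forall k, \sum_l M k l * u l = b k) ->
  forall l, \det M * u l = \sum_k (\adj M) l k * b k.
Proof.
move=> Mu l.
have /matrixP/(_ l ord0) adjM : \adj M *m (M *m \col_i u i) = \det M *: \col_i u i.
  by rewrite mulmxA mul_adj_mx mul_scalar_mx.
transitivity ((\det M *: \col_i u i) l ord0); first by rewrite !mxE.
rewrite -adjM mxE; apply: eq_bigr => k _; rewrite -Mu; congr (_ * _).
by rewrite mxE; apply: eq_bigr => i _; rewrite mxE.
Qed.

Section Iteration.
Context (R : realType) (n : nat) (lam : 'I_n -> nat).
Hypothesis lam_gt0 : forall i, (0 < lam i)%N.

(** Cramer's rule expresses $c\,w^a u_l$ through three terms: the data term, small by its order; the
    quadratic term; and $(\det A - c\,w^a) u_l$, whose first factor has order at least [p.+1], so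
    that only the bound [X] up to weight [K] is used. Dividing by $w^a$ then reaches weight
    [K.+1]. *)
Lemma contraction_step (m p : nat) (a : multinom n) (c : R[i])
    (A : 'M[fps R[i] n]_m) (u f q : 'I_m -> fps R[i] n) (K : nat)
    (s s0 BG BE BA Bq X : R) :
  wt lam a = p ->
  (forall k, \sum_l A k l * u l = - (f k + q k)) ->
  wtord lam p.+1 (\det A - c *: fps_mono _ a) ->
  (forall l, wtord lam (2 * p).+1 (\sum_k (\adj A) l k * f k)) ->
  0 < s -> s <= s0 ->
  (forall l M, wnorm lam s0 M (\sum_k (\adj A) l k * f k) <= BG) ->
  (forall M, wnorm lam s0 M (\det A - c *: fps_mono _ a) <= BE) ->
  (forall l k M, wnorm lam s0 M ((\adj A) l k) <= BA) ->
  (forall k, wnorm lam s (K + p.+1) (q k) <= Bq) ->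
  (forall l, wnorm lam s K (u l) <= X) ->
  forall l, Normc.normc c * s ^+ p * wnorm lam s K.+1 (u l) <=
    (s / s0) ^+ (2 * p).+1 * BG + m%:R * (BA * Bq) + (s / s0) ^+ p.+1 * BE * X.
Proof.
move=> ap Au Eord Gord s_gt0 ss0 GB EB AB qB uB l.
have s0' : 0 <= s by exact: ltW.
have s0_gt0 : 0 < s0 by exact: lt_le_trans ss0.
have detu : \det A * u l = - ((\sum_k (\adj A) l k * f k) + \sum_k (\adj A) l k * q k).
  rewrite (adj_solve Au) -big_split/= -sumrN; apply: eq_bigr => k _.
  by rewrite -mulrDr mulrN.
have -> : Normc.normc c * s ^+ p * wnorm lam s K.+1 (u l) =
    Normc.normc c * (s ^+ wt lam a * wnorm lam s K.+1 (u l)) by rewrite ap mulrA.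
have := wnorm_mono_ge lam_gt0 K.+1 a (u l) s0'.
move=> /(ler_wpM2l (normc_ge0 c)) /le_trans; apply.
rewrite -wnormZ ap addSnnS.
have -> : c *: (fps_mono _ a * u l) = - (\sum_k (\adj A) l k * f k) -
    \sum_k (\adj A) l k * q k - (\det A - c *: fps_mono _ a) * u l.
  by rewrite mulrBl -scalerAl detu; ring.
rewrite (le_trans (wnormB _ _ _ _ s0'))// lerD//.
  rewrite (le_trans (wnormB _ _ _ _ s0'))// lerD//.
    rewrite wnormN (le_trans (wnorm_scale _ s0' ss0 s0_gt0 (Gord l)))//.
    by rewrite ler_wpM2l// exprn_ge0// divr_ge0// ltW.
  rewrite (le_trans (wnorm_sum _ _ _ _ _ s0'))//.
  apply: (@le_trans _ _ (\sum_(k < m) BA * Bq)).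
    apply: ler_sum => k _; rewrite (le_trans (wnormM _ _ _ _ s0'))//.
    rewrite ler_pM ?wnorm_ge0//.
    have := wnorm_scale (K + p.+1) s0' ss0 s0_gt0 (@wtord_0 _ lam _ ((\adj A) l k)).
    by rewrite expr0 mul1r => /le_trans; exact.
  by rewrite sumr_const card_ord mulr_natl.
rewrite (le_trans (wnormM_ord _ _ s0' Eord (@wtord_0 _ lam _ (u l))))//.
rewrite addnK subn0 ler_pM ?wnorm_ge0//.
rewrite (le_trans (wnorm_scale _ s0' ss0 s0_gt0 Eord))//.
by rewrite ler_wpM2l// exprn_ge0// divr_ge0// ltW.
Qed.

Lemma wtord_initial (K : comNzRingType) (D : fps K n) a :
  (forall b, D b != 0 -> b != a -> (wt lam a < wt lam b)%N) ->
  wtord lam (wt lam a).+1 (D - D a *: fps_mono K a).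
Proof.
move=> Da b bp; rewrite fps_coefB fps_coefZ/=.
have [->|ba] := eqVneq b a; first by rewrite mulr1 subrr.
rewrite mulr0 subr0; apply/eqP/negPn/negP => Db.
by move: (Da b Db ba); rewrite ltnNge -ltnS bp.
Qed.

(** With [th] and then [s] small enough, the bound $\theta s^p r$ on [u] reproduces itself under
    [contraction_step], hence holds at every weight. *)
Lemma iteration_bound (m p : nat) (a : multinom n) (c : R[i])
    (A : 'M[fps R[i] n]_m) (u f q : 'I_m -> fps R[i] n) (s0 r C : R) :
  wt lam a = p -> c != 0 -> 0 < s0 -> s0 <= 1 -> 0 < r -> 0 <= C ->
  (forall k, \sum_l A k l * u l = - (f k + q k)) ->
  wtord lam p.+1 (\det A - c *: fps_mono _ a) ->
  (forall l, wtord lam p.+1 (u l)) ->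
  (forall k, wtord lam (p.+1 + p.+1) (q k)) ->
  (forall k l, wbounded lam s0 (A k l)) ->
  (forall k, wbounded lam s0 (f k)) ->
  (forall s x K, 0 < s -> s <= s0 -> 0 <= x -> x <= 4^-1 ->
     (forall l, wnorm lam s K (u l) <= x * r) ->
     forall k, wnorm lam s (K + p.+1) (q k) <= 4 * C * x ^+ 2) ->
  exists s, [/\ 0 < s, s <= s0 & forall l, wbounded lam s (u l)].
Proof.
move=> ap c0 s0_gt0 s01 r0 C0 Au Eord uord qord Ab fb qb.
have s0_ge0 := ltW s0_gt0.
pose G l := \sum_k (\adj A) l k * f k.
pose E := \det A - c *: fps_mono _ a.
have adjb l k : wbounded lam s0 ((\adj A) l k) by exact: wbounded_adj.
have [BG BG0 GB] : exists2 B, 0 < B & forall l M, wnorm lam s0 M (G l) <= B.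
  apply: (uniform_bound (u := fun l M => wnorm lam s0 M (G l))) => l.
  by apply: wbounded_sum => // k _; exact: wboundedM.
have [BA BA0 AB] : exists2 B, 0 < B &
    forall lk M, wnorm lam s0 M ((\adj A) lk.1 lk.2) <= B.
  pose w (lk : 'I_m * 'I_m) M := wnorm lam s0 M ((\adj A) lk.1 lk.2).
  by apply: (uniform_bound (u := w)) => lk; exact: adjb.
have [BE BE0 EB] : exists2 B, 0 < B & forall M, wnorm lam s0 M E <= B.
  have [|B B0 EB] :=
      uniform_bound (I := unit) (u := fun _ M => wnorm lam s0 M E); last first.
    by exists B => // M; exact: (EB tt).
  move=> _; apply: wboundedD => //; first exact: wbounded_det.
  apply/wboundedN/wboundedZ/(wbounded_poly lam_gt0 (N := wt lam a)) => // b.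
  by move=> ab /=; case: eqP ab => // ->; rewrite ltnn.
(* The order is read off the equation: $\det A\, u_l$ has order at least $p + (p+1)$ and the
   quadratic term at least $2p + 2$. *)
have Gord l : wtord lam (2 * p).+1 (G l).
  have -> : G l = - (\det A * u l) - \sum_k (\adj A) l k * q k.
    rewrite (adj_solve Au) -!sumrN -big_split/=; apply: eq_bigr => k _.
    by ring.
  rewrite mul2n -addnn; apply: wtordB.
    rewrite -addnS; apply/wtordN/wtordM => //.
    rewrite -[\det A](subrK (c *: fps_mono _ a)); apply: wtordD.
      by apply: wtord_le Eord.
    apply: wtordZ => b bp /=; case: eqP bp => // ->; by rewrite ap ltnn.
  apply: wtord_sum => k _; apply: wtordMl => //.
  by apply: wtord_le (qord k); rewrite addSn ltnS leq_add2l.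
pose c' := Normc.normc c.
have c'0 : 0 < c'.
  by rewrite lt_def normc_ge0 andbT; apply: contra c0 => /eqP/Normc.eq0_normc ->.
(* [th] is fixed first, independently of [s], so that the quadratic term takes at most half of the
   target bound; [s] is then chosen, depending on [th], so that the two other terms take at most the
   other half. *)
have [th [th0 th4 thZ]] : exists t, [/\ 0 < t, t <= 4^-1 &
    (m%:R * (BA * (4 * C))) * t <= c' * r / 2].
  apply: small_scalar => //;
  by rewrite ?divr_gt0 ?mulr_gt0 ?mulr_ge0 ?(ltW BA0) ?invr_gt0.
pose Y := s0 ^- (2 * p).+1 * BG + s0 ^- p.+1 * BE * (th * r).
have Y0 : 0 <= Y.
  by rewrite addr_ge0// !mulr_ge0 ?invr_ge0 ?exprn_ge0// ltW.
have [s [s_gt0 ss0 sY]] : exists t, [/\ 0 < t, t <= s0 & Y * t <= c' * th * r / 2].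
  by apply: small_scalar => //; rewrite ?divr_gt0 ?mulr_gt0.
have s_ge0 := ltW s_gt0.
have s1 : s <= 1 by exact: le_trans s01.
exists s; split=> // l; exists (th * s ^+ p * r) => K.
pose x := th * s ^+ p.
have x0 : 0 <= x by rewrite mulr_ge0 ?exprn_ge0// ltW.
have sp1 : s ^+ p <= 1 by rewrite exprn_ile1.
have x4 : x <= 4^-1 by rewrite (le_trans _ th4)// ler_piMr// ltW.
(* At weight 0 the truncated norm vanishes, the order of [u] being at least [p.+1]. *)
elim: K l => [|K IH] l.
  rewrite (wnorm_ord0 lam_gt0); first exact: (mulr_ge0 x0 (ltW r0)).
  exact: (wtord_le _ (uord l)).
have qK k : wnorm lam s (K + p.+1) (q k) <= 4 * C * x ^+ 2 by exact: qb.
have AB' i k M : wnorm lam s0 M ((\adj A) i k) <= BA by exact: (AB (i, k)).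
have step := contraction_step ap Au Eord Gord s_gt0 ss0 GB EB AB' qK IH l.
have t_gt0 : 0 < c' * s ^+ p by rewrite mulr_gt0 ?exprn_gt0.
rewrite -(ler_pM2l t_gt0) (le_trans step)//.
(* All three terms carry $s^{2p}$, as does the target: one $s^p$ from the division by $w^a$, one
   from the bound on [u]. After cancellation the first and last terms keep a factor [s], the
   quadratic one a factor $\theta^2$. *)
have -> : (s / s0) ^+ (2 * p).+1 * BG + m%:R * (BA * (4 * C * x ^+ 2)) +
    (s / s0) ^+ p.+1 * BE * (th * s ^+ p * r) =
    s ^+ p * s ^+ p * ((s0 ^- (2 * p).+1 * BG + s0 ^- p.+1 * BE * (th * r)) * s +
     (m%:R * (BA * (4 * C))) * th * th).
  rewrite /x !expr_div_n exprS mul2n -addnn exprD [s ^+ p.+1]exprS; ring.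
rewrite -/Y.
have -> : c' * s ^+ p * (th * s ^+ p * r) = s ^+ p * s ^+ p *
   (c' * th * r / 2 + (c' * r / 2) * th) by field.
rewrite ler_wpM2l ?mulr_ge0 ?exprn_ge0//.
by rewrite lerD// ler_wpM2r// ltW.
Qed.

End Iteration.

(** * Expansion at the truncated solution and conclusion *)

Theorem theorem1p3p2 (R : realType) (n m J : nat)
    (F : 'I_J -> fps R[i] (n + m)) (g : 'I_m -> fps R[i] n)
    (F_convergent : forall j, fps_convergent (F j))
    (g_const0 : forall l, g l mnm0 = 0)
    (F_g : forall j, fps_subst_y (F j) g = 0)
    (m_le_J : (m <= J)%N)
    (det_neq0 : exists j : 'I_m -> 'I_J,
      (forall k l : 'I_m, (k < l)%N -> (j k < j l)%N) /\
      \det (\matrix_(k < m, l < m)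
              fps_subst_y (fps_deriv (rshift n l) (F (j k))) g) <> 0) :
  forall l, fps_convergent (g l).
Proof.
have [j [_]] := det_neq0; set A0 := \matrix_(_, _) _ => D0.
have [lam [a [lam_gt0 Da amin]]] := initial_monomial D0.
pose p := wt lam a.
pose h l : fps R[i] n := Fps (fun b => if (wt lam b <= p)%N then g l b else 0).
pose u l := g l - h l.
(* The base point is $(w, h)$ and the increment $(0, u)$: the variables [w] do not move, so only the
   derivatives in the last [m] variables survive. *)
pose y (k : 'I_(n + m)) : fps R[i] n :=
  match fintype.split k with inl i => fps_X _ i | inr l => h l end.
pose v (k : 'I_(n + m)) : fps R[i] n :=
  match fintype.split k with inl i => 0 | inr l => u l end.
have split_l i : fintype.split (lshift m i) = inl i by exact: (unsplitK (inl i)).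
have split_r l : fintype.split (rshift n l) = inr l by exact: (unsplitK (inr l)).
have u_ord l : wtord lam p.+1 (u l).
  by move=> b bp; rewrite fps_coefB/= -ltnS bp subrr.
have v_ord k : wtord lam p.+1 (v k).
  by rewrite /v; case: fintype.split => [i|l] //; exact: u_ord.
have v0 k : v k mnm0 = 0 by apply: v_ord; rewrite wt0.
have y0 k : y k mnm0 = 0.
  rewrite /y; case: fintype.split => [i|l] /=; last by rewrite wt0/= g_const0.
  by rewrite eq_sym mnm1_eq0.
have subst_yE G : fps_subst_y G g = fps_subst G (fun k => y k + v k).
  congr fps_subst; apply: funext => k; rewrite /y /v.
  by case: fintype.split => [i|l]; rewrite ?addr0// /u addrC subrK.
have [r r0 Fr] : exists2 r, 0 < r & forall k, wbounded (fun=> 1%N) r (F (j k)).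
  apply: uniform_radius => [k|k r t t0 tr]; first exact: convergent_wbounded.
  have r0 : 0 < r by exact: lt_le_trans tr.
  exact: wbounded_le (ltW t0) tr r0.
have [C C0 FC] := uniform_bound (u := fun k M => wnorm (fun=> 1%N) r M (F (j k))) Fr.
have hb l : wbounded lam 1 (h l).
  by apply: (wbounded_poly lam_gt0 (N := p)) => // b; rewrite ltnNge /= => /negbTE ->.
have yb k : wbounded lam 1 (y k).
  rewrite /y; case: fintype.split => [i|l] //.
  apply: (wbounded_poly lam_gt0 (N := lam i)) => // b bi /=.
  by case: eqP bi => // ->; rewrite wt1 ltnn.
(* The value [r / 4] is the one required by [wnorm_subst_rem]; it is also below [r / 2], the radius
   at which the derivatives are bounded. *)
have [s0 [s0_gt0 s01 ys]] := small_radius lam_gt0 (divr_gt0 r0 (ltr0n _ 4)) y0 yb.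
have s0_ge0 := ltW s0_gt0.
pose A : 'M[fps R[i] n]_m :=
  \matrix_(k, l) fps_subst (fps_deriv (rshift n l) (F (j k))) y.
pose f k := fps_subst (F (j k)) y.
pose q k := subst_rem (F (j k)) y v.
have Au k : \sum_l A k l * u l = - (f k + q k).
  have -> : \sum_l A k l * u l =
      \sum_(i < n + m) fps_subst (fps_deriv i (F (j k))) y * v i.
    rewrite big_split_ord/= [X in _ = X + _]big1 ?add0r; last first.
      by move=> i _; rewrite /v split_l mulr0.
    by apply: eq_bigr => l _; rewrite mxE /v split_r.
  have := F_g (j k); rewrite subst_yE /q /f /subst_rem => ->.
  by ring.
(* Since [u] has order at least [p.+1], replacing the solution by [h] changes the determinant only
   in weights above [p] and keeps its initial monomial. *)
have Eord : wtord lam p.+1 (\det A - \det A0 a *: fps_mono _ a).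
  rewrite -[\det A](subrK (\det A0)) -addrA; apply: wtordD; last exact: wtord_initial.
  apply: wtord_det_sub => // k l; rewrite !mxE subst_yE.
  apply: wtord_subst_sub => // i; first by rewrite fps_coefD y0 v0 addr0.
  by rewrite opprD addrA subrr add0r; apply: wtordN.
have [|k l|k|s x K s_gt0 ss0 x0 x4 ux k|s [s_gt0 ss0 ub]] :=
    iteration_bound lam_gt0 (erefl p) Da s0_gt0 s01 r0 (ltW C0) Au Eord u_ord.
- by move=> k; apply: wtord_subst_rem.
- rewrite mxE; apply: (wbounded_subst lam_gt0 (r := r / 2)) => //.
  + by rewrite divr_ge0// ltW.
  + by move=> i M; rewrite (le_trans (ys i M))//; lra.
  + exact: wbounded_deriv.
- apply: (wbounded_subst lam_gt0 (r := r)) => //; first exact: ltW.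
  by move=> i M; rewrite (le_trans (ys i M))//; lra.
- apply: (wnorm_subst_rem lam_gt0 (ltW s_gt0) (ltW r0) x0 x4 y0 v0 _ v_ord _ (FC k)).
    move=> i; apply: le_trans (ys i (K + p.+1)%N).
    have := wnorm_scale (K + p.+1) (ltW s_gt0) ss0 s0_gt0 (@wtord_0 _ lam _ (y i)).
    by rewrite expr0 mul1r.
  move=> i; rewrite /v; case: fintype.split => [_|l]; last exact: ux.
  by rewrite wnorm0 mulr_ge0// ltW.
move=> l; apply: (wbounded_convergent lam_gt0 s_gt0 (le_trans ss0 s01)).
(* The solution is [u l] plus the polynomial [h l]. *)
rewrite -[g l](subrK (h l)); apply: wboundedD (ub l) _; first exact: ltW.
exact: wbounded_le (ltW s_gt0) (le_trans ss0 s01) ltr01 (hb l).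
Qed.
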